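(* Let $K$ be a field, $R=K[x_1,\ldots,x_n]$, $G\subseteq R$ a finite set of nonzero polynomials, $\sigma$ an ordering, $r\in R$ nonzero, and $\Omega$ the set of boundary vectors of the cone $C(\sigma,G)$ (for a fixed real $d>0$). Write $t=\mathrm{lt}_\sigma(r)$. If there exists $\tau\in C(\sigma,G)$ such that $\mathrm{lt}_\tau(r)=u\neq t$, then there exists $\omega\in\Omega$ such that $\omega\cdot(\mathbf{u}-\mathbf{t})>0$.
   Context: A term of $R=K[x_1,\ldots,x_n]$ is a product of powers of the variables; the exponent vector of a term is denoted by its name in boldface, so $t=x_1^{t_1}\cdots x_n^{t_n}$ has $\mathbf{t}=(t_1,\ldots,t_n)$. For $r\in R$, $\mathrm{supp}(r)$ is the set of terms appearing in $r$ with nonzero coefficient. Orderings are represented by weight vectors: an ordering $\sigma$ is given by a vector in $\mathbb{R}^n$ with positive entries, and $\mathrm{lt}_\sigma(r)=t$ (the leading term of $r$ with respect to $\sigma$ is $t$) means that $t\in\mathrm{supp}(r)$ and $\sigma\cdot\mathbf{t}>\sigma\cdot\mathbf{u}$ for every $u\in\mathrm{supp}(r)\setminus\{t\}$, where $\cdot$ is the usual dot product. It is understood that $\sigma$ determines a leading term of every $g\in G$ and of $r$ in this sense. For $t\in\mathrm{supp}(g)$ let $$\mathrm{lp}(y,t,g)=\{y_k>0\}_{k=1}^n\cup\Big\{\sum_{k=1}^n y_k(t_k-u_k)>0\Big\}_{u\in\mathrm{supp}(g)\setminus\{t\}},$$ a system of linear inequalities in unknowns $y_1,\ldots,y_n$,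 and let $\mathrm{lp}(\sigma,G)=\bigcup_{g\in G}\mathrm{lp}(y,\mathrm{lt}_\sigma(g),g)$. The cone $C(\sigma,G)$ (also written $C(G,\sigma)$) is the set of solutions in $\mathbb{R}^n$ of $\mathrm{lp}(\sigma,G)$, i.e. the set of orderings that choose the same leading term as $\sigma$ for every $g\in G$. The closure of $C(\sigma,G)$ is the feasible region obtained by rewriting the inequalities of $\mathrm{lp}(\sigma,G)$ as inclusive inequalities ($\geq$ in place of $>$). For a real number $d>0$, a vector $\omega\in\mathbb{R}^n$ is a boundary vector of $C(\sigma,G)$ if it is an extreme point of the intersection of the closure of $C(\sigma,G)$ with the hyperplane $\sum_{k=1}^n y_k=d$. The set of all boundary vectors for a fixed $d$ is denoted $\Omega$. *)

(* Defs.v *)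
From mathcomp Require Import all_boot all_order all_algebra.
From mathcomp Require Import finmap mpoly classical_sets reals.

Set Implicit Arguments.
Unset Strict Implicit.
Unset Printing Implicit Defensive.

Import GRing.Theory Num.Theory.

Local Open Scope ring_scope.
Local Open Scope classical_set_scope.

Definition dot (R : realType) (n : nat) (y z : 'rV[R]_n) : R :=
  \sum_(k < n) y 0 k * z 0 k.

Definition expvec (R : realType) (n : nat) (m : 'X_{1..n}) : 'rV[R]_n :=
  \row_(k < n) (m k)%:R.

Definition is_ordering (R : realType) (n : nat) (sigma : 'rV[R]_n) : Prop :=
  forall k, 0 < sigma 0 k.

(* A weight vector may tie on the support of p, so the leading term is a
   relation, functional in t, rather than a total function of p. *)
Definition is_lt (R : realType) (n : nat) (K : fieldType) (sigma : 'rV[R]_n)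
    (p : {mpoly K[n]}) (t : 'X_{1..n}) : Prop :=
  t \in msupp p /\
  forall u, u \in msupp p -> u != t ->
    dot sigma (expvec R t) > dot sigma (expvec R u).

(* Homogeneous systems of linear inequalities in y are encoded by their sets of
   coefficient vectors a, each standing for dot y a > 0 (or dot y a >= 0 in the
   inclusive version); delta_mx 0 k encodes y_k > 0. *)
Definition lp_pos (R : realType) (n : nat) : set 'rV[R]_n :=
  [set delta_mx 0 k | k in [set: 'I_n]].
Arguments lp_pos : clear implicits.

Definition lp_term (R : realType) (n : nat) (K : fieldType) (t : 'X_{1..n})
    (g : {mpoly K[n]}) : set 'rV[R]_n :=
  lp_pos R n `|`
  [set expvec R t - expvec R u | u in [set u | u \in msupp g /\ u != t]].
Arguments lp_term R {n K}.

(* lp_pos is redundant here unless G is empty, in which case it makes the cone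
   the set of all orderings rather than the whole space. *)
Definition lp (R : realType) (n : nat) (K : fieldType) (sigma : 'rV[R]_n)
    (G : {fset {mpoly K[n]}}) : set 'rV[R]_n :=
  lp_pos R n `|`
  [set a | exists g t, [/\ g \in G, is_lt sigma g t & lp_term R t g a]].

Definition cone (R : realType) (n : nat) (K : fieldType) (sigma : 'rV[R]_n)
    (G : {fset {mpoly K[n]}}) : set 'rV[R]_n :=
  [set y | forall a, lp sigma G a -> dot y a > 0].

Definition cone_closure (R : realType) (n : nat) (K : fieldType)
    (sigma : 'rV[R]_n) (G : {fset {mpoly K[n]}}) : set 'rV[R]_n :=
  [set y | forall a, lp sigma G a -> dot y a >= 0].

Definition extreme_point (R : realType) (V : lmodType R) (A : set V) (x : V) :
    Prop :=
  A x /\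
  forall (y z : V) (c : R), A y -> A z -> 0 < c < 1 ->
    x = c *: y + (1 - c) *: z -> y = x /\ z = x.

Definition boundary_vectors (R : realType) (n : nat) (K : fieldType)
    (sigma : 'rV[R]_n) (G : {fset {mpoly K[n]}}) (d : R) : set 'rV[R]_n :=
  [set omega | extreme_point
     (cone_closure sigma G `&` [set y : 'rV[R]_n | \sum_(k < n) y 0 k = d])
     omega].

(* Main.v *)
Require Import Defs.
From mathcomp Require Import all_boot all_order all_algebra.
From mathcomp Require Import finmap mpoly boolp classical_sets reals.
From mathcomp Require Import ring lra.

(** The vector [tau], rescaled to coordinate sum [d], lies in the slice of the
    closed cone by the hyperplane of sum [d], and it gives the linear form
    [y |-> y . (u - t)] a positive value, since [tau] prefers [u] to [t].  So
    the theorem is an instance of a fact of linear programming: a linear form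
    that is positive somewhere on a polytope is positive at a vertex.

    That fact is proved without compactness, by counting slack constraints.
    When a feasible point [x] is not extreme, it is interior to a feasible
    segment; let [v] be its direction.  The constraints tight at [x] do not
    vary along [v], and one of [v], [-v] does not decrease the form.  The
    coordinates of that direction sum to 0, so some coordinate decreases along
    it, and the ray from [x] leaves the polytope.  At its exit point
    ([ratio_test]) a slack constraint has become tight and none has been lost
    ([fewer_slack]).  As the number of constraints is finite
    ([lp_sub_constraints]), the process ends, at an extreme point
    ([extreme_point_dot_gt0]). *)

Set Implicit Arguments.
Unset Strict Implicit.
Unset Printing Implicit Defensive.

Import Order.TTheory GRing.Theory Num.Theory.

Local Open Scope ring_scope.
Local Open Scope classical_set_scope.

Section Dot.
Variables (R : realType) (n : nat).
Implicit Types (y z v a : 'rV[R]_n).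

Lemma dotDl y z a : dot (y + z) a = dot y a + dot z a.
Proof.
by rewrite /dot -big_split; apply: eq_bigr => k _; rewrite mxE mulrDl.
Qed.

Lemma dotZl c y a : dot (c *: y) a = c * dot y a.
Proof.
by rewrite /dot mulr_sumr; apply: eq_bigr => k _; rewrite mxE mulrA.
Qed.

Lemma dotNl y a : dot (- y) a = - dot y a.
Proof. by rewrite -scaleN1r dotZl mulN1r. Qed.

Lemma dotBr y a b : dot y (a - b) = dot y a - dot y b.
Proof.
by rewrite /dot -sumrB; apply: eq_bigr => k _; rewrite !mxE mulrBr.
Qed.

Lemma dot_delta y k : dot y (delta_mx 0 k) = y 0 k.
Proof.
rewrite /dot (bigD1 k) //= big1 => [|j jk]; rewrite mxE eqxx.
  by rewrite eqxx mulr1 addr0.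
by rewrite (negPf jk) mulr0.
Qed.

Lemma dot_const1 y : dot y (const_mx 1) = \sum_(k < n) y 0 k.
Proof. by apply: eq_bigr => k _; rewrite mxE mulr1. Qed.

Lemma exists_coord_lt0 v :
  \sum_(k < n) v 0 k = 0 -> v != 0 -> exists k, v 0 k < 0.
Proof.
move=> sv0 /eqP v0; apply: contrapT => nneg; apply: v0.
have v_ge0 k : 0 <= v 0 k.
  by rewrite leNgt; apply/negP => vk; apply: nneg; exists k.
apply/rowP => k; rewrite mxE.
by apply: (psumr_eq0P (P := predT)) sv0 _ _ => // i _.
Qed.

End Dot.

Section VertexOfPolytope.
Variables (R : realType) (n : nat).
Implicit Types (x y z v w a : 'rV[R]_n) (A : seq 'rV[R]_n).

Definition feasible A y : Prop := forall a, a \in A -> 0 <= dot y a.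

Definition slack A y : nat := count (fun a => dot y a != 0) A.

(** The step length is the least of the ratios [dot x a / - dot v a] over the
    constraints [a] that decrease along [v]; the minimising constraint is the
    one that becomes tight. *)
Lemma ratio_test A x v a0 :
  feasible A x -> a0 \in A -> dot v a0 < 0 ->
  exists s b, [/\ 0 <= s, feasible A (x + s *: v), b \in A, dot v b < 0 &
                  dot (x + s *: v) b = 0].
Proof.
move=> Ax a0A va0.
pose ratio a := dot x a / - dot v a.
case: (arg_minP (i0 := SeqSub a0A : seq_sub A)
  (P := fun i => dot v (ssval i) < 0) (fun i => ratio (ssval i)) va0)
  => -[b bA] /= vb ratio_min.
have s_ge0 : 0 <= ratio b by rewrite divr_ge0 ?oppr_ge0 ?(ltW vb) ?Ax.
exists (ratio b), b; split => //.
- move=> a aA; rewrite dotDl dotZl.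
  have [va|va] := ltP (dot v a) 0; last first.
    by apply: addr_ge0; [exact: Ax | exact: mulr_ge0].
  have := ratio_min (SeqSub aA) va; rewrite /= [leRHS]/ratio.
  by rewrite ler_pdivlMr ?oppr_gt0 // mulrN; lra.
- by rewrite dotDl dotZl /ratio; field; rewrite lt_eqF.
Qed.

Lemma fewer_slack A x v w :
  (forall k, delta_mx 0 k \in A) -> feasible A x -> 0 < dot x w ->
  \sum_(k < n) v 0 k = 0 -> v != 0 ->
  (forall a, a \in A -> dot x a = 0 -> dot v a = 0) ->
  exists x', [/\ feasible A x',
    \sum_(k < n) x' 0 k = \sum_(k < n) x 0 k, 0 < dot x' w &
    (slack A x' < slack A x)%N].
Proof.
move=> deltaA Ax xw; wlog vw : v / 0 <= dot v w => [hwlog sv v0 tight|].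
  have [vw|/ltW vw] := leP 0 (dot v w); first exact: (hwlog v).
  apply: (hwlog (- v)); rewrite ?oppr_eq0 //.
  - by rewrite dotNl oppr_ge0.
  - by rewrite -dot_const1 dotNl dot_const1 sv oppr0.
  - by move=> a aA xa; rewrite dotNl tight // oppr0.
move=> sv v0 tight.
have [k vk] := exists_coord_lt0 sv v0.
rewrite -dot_delta in vk.
have [s [b [s_ge0 Ax' bA vb x'b]]] := ratio_test Ax (deltaA k) vk.
exists (x + s *: v); split => //.
- by rewrite -!dot_const1 dotDl dotZl (dot_const1 v) sv mulr0 addr0.
- by rewrite dotDl dotZl ltr_wpDr // mulr_ge0.
have xb : dot x b != 0.
  by apply/eqP => xb; rewrite tight // ltxx in vb.
have slack_sub a :
    a \in A -> dot (x + s *: v) a != 0 -> dot x a != 0.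
  by move=> aA; apply: contraNN => /eqP xa; rewrite dotDl dotZl tight // xa
    mulr0 addr0.
(* Among the constraints slack at [x], which include all those slack at the
   exit point, [b] is not slack at the exit point. *)
rewrite /slack -[ltnRHS]size_filter.
rewrite (@eq_in_count _ _ (predI (fun a => dot (x + s *: v) a != 0)
  (fun a => dot x a != 0))) => [|a aA /=]; last first.
  by apply/esym/andb_idr; apply: slack_sub.
rewrite -count_filter ltn_neqAle count_size andbT -all_count.
by apply/allPn; exists b; rewrite ?mem_filter ?xb // x'b eqxx.
Qed.

(** The non-negativity constraints, required through the [delta_mx 0 k], make
    the slice bounded; without them it could fail to have a vertex. *)
Lemma extreme_point_dot_gt0 A (d : R) w x :
  (forall k, delta_mx 0 k \in A) ->
  feasible A x -> \sum_(k < n) x 0 k = d -> 0 < dot x w ->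
  exists omega,
    extreme_point
      (feasible A `&` [set y : 'rV[R]_n | \sum_(k < n) y 0 k = d]) omega /\
    0 < dot omega w.
Proof.
move=> deltaA.
have [m] := ubnP (slack A x); elim: m x => // m IHm x slack_x Ax sx xw.
have [better|no_better] := pselect (exists x', [/\ feasible A x',
    \sum_(k < n) x' 0 k = \sum_(k < n) x 0 k, 0 < dot x' w &
    (slack A x' < slack A x)%N]).
  have [x' [Ax' sx' x'w lt_x'x]] := better.
  by apply: (IHm x') => //; [apply: leq_trans lt_x'x _ | rewrite sx'].
exists x; split=> //; split=> // y z c [Ay sy] [Az sz] /andP[c_gt0 c_lt1] xE.
have [yz|yz] := eqVneq y z.
  by rewrite xE -yz -scalerDl addrC subrK scale1r.
exfalso; apply: no_better; apply: (@fewer_slack A x (y - z)) => //.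
- by rewrite -dot_const1 dotDl dotNl !dot_const1 sy sz subrr.
- by rewrite subr_eq0.
(* A convex combination of non-negative values vanishes only if both do. *)
move=> a aA; rewrite xE dotDl !dotZl dotDl dotNl => xa.
have c1_gt0 : 0 < 1 - c by rewrite subr_gt0.
have ya := Ay a aA; have za := Az a aA.
move/eqP: xa; rewrite paddr_eq0 ?mulr_ge0 ?(ltW c_gt0) ?(ltW c1_gt0) //.
by rewrite !mulf_eq0 (gt_eqF c_gt0) (gt_eqF c1_gt0) => /andP[/eqP-> /eqP->];
  rewrite subrr.
Qed.

End VertexOfPolytope.

(** All candidate constraints, whatever the leading terms are: a finite list
    that does not depend on the ordering. *)
Definition constraints (R : realType) (n : nat) (K : fieldType)
    (G : {fset {mpoly K[n]}}) : seq 'rV[R]_n :=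
  [seq delta_mx 0 k | k <- enum 'I_n] ++
  flatten [seq [seq expvec R t - expvec R u | t <- msupp g, u <- msupp g]
          | g <- enum_fset G].

Lemma lp_sub_constraints (R : realType) (n : nat) (K : fieldType)
    (sigma : 'rV[R]_n) (G : {fset {mpoly K[n]}}) a :
  lp sigma G a -> a \in constraints R G.
Proof.
have pos b : lp_pos R n b -> b \in constraints R G.
  by case=> k _ <-; rewrite mem_cat map_f ?mem_enum.
case=> [/pos//|[g [t [gG [tg _] [/pos//|[u [ug _] <-]]]]]].
rewrite mem_cat; apply/orP; right; apply/flatten_mapP; exists g => //.
exact: allpairs_f.
Qed.

Theorem theorem14 (R : realType) (n : nat) (K : fieldType)
    (G : {fset {mpoly K[n]}}) (hG : 0 \notin G)
    (sigma : 'rV[R]_n) (hsigma : is_ordering sigma)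
    (hltG : forall g, g \in G -> exists t, is_lt sigma g t)
    (r : {mpoly K[n]}) (hr : r != 0)
    (d : R) (hd : 0 < d)
    (t u : 'X_{1..n}) (ht : is_lt sigma r t) (hut : u != t)
    (htau : exists tau, cone sigma G tau /\ is_lt tau r u) :
  exists omega, boundary_vectors sigma G d omega /\
    0 < dot omega (expvec R u - expvec R t).
Proof.
have [tau [tauG [_ tau_u]]] := htau.
have tau_ut : 0 < dot tau (expvec R u - expvec R t).
  by rewrite dotBr subr_gt0 tau_u 1?eq_sym //; case: ht.
have tau_gt0 k : 0 < tau 0 k.
  by rewrite -dot_delta; apply: tauG; left; exists k.
have sum_gt0 : 0 < \sum_(k < n) tau 0 k.
  rewrite lt_def sumr_ge0 => [|k _]; last exact: ltW.
  rewrite andbT; apply: contraTneq tau_ut => /psumr_eq0P tau0.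
  rewrite -leNgt /dot big1 // => k _.
  by rewrite tau0 ?mul0r // => i _; apply: ltW.
pose A := [seq a <- constraints R G | `[< lp sigma G a >]].
have AP a : a \in A <-> lp sigma G a.
  rewrite mem_filter; split=> [/andP[/asboolP//]|lpa].
  by rewrite (lp_sub_constraints lpa) andbT; apply/asboolP.
have closureE : cone_closure sigma G = feasible A.
  by apply/seteqP; split=> y hy a /AP; apply: hy.
pose c := d / \sum_(k < n) tau 0 k.
have c_gt0 : 0 < c by rewrite divr_gt0.
rewrite /boundary_vectors closureE /=.
apply: (@extreme_point_dot_gt0 _ _ A d _ (c *: tau)).
- by move=> k; apply/AP; left; exists k.
- by move=> a /AP/tauG tau_a; rewrite dotZl mulr_ge0 ?ltW.
- by rewrite -dot_const1 dotZl dot_const1 divfK ?gt_eqF.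
- by rewrite dotZl mulr_gt0.
Qed.
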